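(* A density matrix $\rho\in\mathbb{D}$ belongs to $\mathrm{conv}(\mathcal{S}_+)$ if and only if $$\Gamma_{\mathcal{S}_+}(\rho)-1=\Gamma_{\mathcal{S}}(\rho)-1=\Gamma_{\mathcal{S}_+\cup(-\mathcal{S}_+)}(\rho)-1=\Gamma^\cup_{\mathcal{S}_+}(\rho)-1=R^{\mathcal{S}_+}_{\mathcal{S}_+}(\rho)=R^{\mathbb{D}}_{\mathcal{S}_+}(\rho)=0.$$ That is, all of these measures are faithful: for each $M$ among the six functions above and each $\rho\in\mathbb{D}$, $M(\rho)=0$ if and only if $\rho\in\mathrm{conv}(\mathcal{S}_+)$.
   Context: Fix $d\ge 1$. $\mathcal{V}\subseteq\mathbb{C}^d$ is a nonempty compact set of unit vectors such that $|\psi\rangle\in\mathcal{V}$ implies $e^{i\theta}|\psi\rangle\in\mathcal{V}$ for all real $\theta$. $\mathbb{D}$ is the set of $d\times d$ density matrices. Put $\mathcal{S}_+=\{|v\rangle\langle v| : |v\rangle\in\mathcal{V}\}$ and $\mathcal{S}=\{|v\rangle\langle w| : |v\rangle,|w\rangle\in\mathcal{V}\}\subseteq\mathbb{C}^{d\times d}$. For a compact set $\mathcal{A}$ in a finite-dimensional vector space, the atomic gauge is $\Gamma_{\mathcal{A}}(x)=\inf\{\lambda\in\mathbb{R}_+ : x\in\lambda\,\mathrm{conv}(\mathcal{A})\}=\inf\{\sum_i c_i : x=\sum_i c_i a_i \text{ (finite sum)},\ a_i\in\mathcal{A},\ c_i\in\mathbb{R}_+\}$, with $\inf\emptyset=\infty$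 (so all functions may take the value $\infty$). The convex roof extension is $$\Gamma^\cup_{\mathcal{S}_+}(\rho)=\inf\Big\{\sum_i p_i\,\Gamma_{\mathcal{V}}(|\psi_i\rangle)^2 : \rho=\sum_i p_i|\psi_i\rangle\langle\psi_i|,\ \sum_i p_i=1,\ p_i\in\mathbb{R}_+\Big\}$$ over finite decompositions with $|\psi_i\rangle$ unit vectors. Let $\mathcal{S}_+^{**}=\mathbb{R}_+\mathrm{conv}(\mathcal{S}_+)$ be the convex cone generated by $\mathcal{S}_+$. For $\mathcal{X}\subseteq\mathbb{D}$ closed, the robustness is $R^{\mathcal{X}}_{\mathcal{S}_+}(\rho)=\inf\{s\in\mathbb{R}_+ : \exists\,\omega\in\mathrm{conv}(\mathcal{X}),\ \rho+s\omega\in\mathcal{S}_+^{**}\}$; the choice $\mathcal{X}=\mathcal{S}_+$ gives the standard robustness and $\mathcal{X}=\mathbb{D}$ the generalised robustness. *)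

(* Defs.v *)
From HB Require Import structures.
From mathcomp Require Import all_boot all_order all_algebra.
From mathcomp Require Import all_classical all_reals all_analysis.
From mathcomp Require Import complex.

Set Implicit Arguments.
Unset Strict Implicit.
Unset Printing Implicit Defensive.

Import Order.TTheory GRing.Theory Num.Theory.
Import numFieldNormedType.Exports.

Local Open Scope classical_set_scope.
Local Open Scope ring_scope.
Local Open Scope complex_scope.
Local Open Scope sesquilinear_scope.

(* R[i] has no topology of its own in the libraries; it gets the one of its
   modulus, so that matrices over R[i] carry the usual (entrywise) topology. *)
HB.instance Definition _ (R : realType) := NormedModule.copy R[i] R[i]^o.

Section AtomicGauge.
Context {R : realType} {E : lmodType R[i]}.
Implicit Types (A : set E) (x : E).

(* E is viewed as a real vector space: all coefficients are reals, embedded in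
   R[i] by _%:C. *)
Definition convex_hull A : set E :=
  [set x | exists (n : nat) (p : 'I_n -> R) (a : 'I_n -> E),
     [/\ forall i, 0 <= p i, forall i, A (a i), \sum_(i < n) p i = 1
       & x = \sum_(i < n) (p i)%:C *: a i]].

Definition dilate (l : R) A : set E := [set l%:C *: x | x in A].

Definition convex_cone A : set E :=
  [set x | exists2 l : R, 0 <= l & dilate l (convex_hull A) x].

Definition atomic_gauge A x : \bar R :=
  ereal_inf [set l%:E | l in
    [set l : R | 0 <= l /\ dilate l (convex_hull A) x]].

Definition robustness (X A : set E) x : \bar R :=
  ereal_inf [set s%:E | s in
    [set s : R | 0 <= s /\
       exists2 w, convex_hull X w & convex_cone A (x + s%:C *: w)]].

End AtomicGauge.

Section QuantumStates.
Context {R : realType} {d : nat}.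
Implicit Types (v w : 'cV[R[i]]_d) (V : set 'cV[R[i]]_d) (rho : 'M[R[i]]_d).

Definition ketbra v w : 'M[R[i]]_d := v *m w^t*.

Definition unit_vector v : Prop := (v^t* *m v) 0 0 = 1.

(* On R[i], 0 <= z means that z is real and nonnegative. *)
Definition density_matrix : set 'M[R[i]]_d :=
  [set rho | [/\ rho \is hermsymmx,
                 forall v, 0 <= (v^t* *m rho *m v) 0 0
               & \tr rho = 1]].

Definition Splus V : set 'M[R[i]]_d := [set ketbra v v | v in V].

Definition Sket V : set 'M[R[i]]_d := [set ketbra v w | v in V & w in V].

Definition Spm V : set 'M[R[i]]_d := Splus V `|` [set - x | x in Splus V].

(* In \bar R, 0 * +oo = 0: a vector of infinite gauge and weight 0 contributes
   nothing. *)
Definition convex_roof V rho : \bar R :=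
  ereal_inf [set c : \bar R |
    exists (n : nat) (p : 'I_n -> R) (psi : 'I_n -> 'cV[R[i]]_d),
      [/\ forall i, 0 <= p i,
          forall i, unit_vector (psi i),
          \sum_(i < n) p i = 1,
          rho = \sum_(i < n) (p i)%:C *: ketbra (psi i) (psi i)
        & c = (\sum_(i < n) (p i)%:E * atomic_gauge V (psi i) ^+ 2)%E]].

End QuantumStates.

(* Main.v *)
(* By Caratheodory's theorem the convex hull of the compact set Splus V is
   compact, hence closed, so it suffices to approximate rho by elements of it.
   Every gauge involved lies above the gauge of Sket V, which is at least 1 on
   states because |<w, v>| <= 1 for unit vectors: for Splus V and Spm V by
   inclusion, and for the convex roof because psi = \sum_j c_j v_j expands
   |psi><psi| into \sum_(j, k) c_j c_k |v_j><v_k|.  If the gauge of Sket V is 1,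
   comparing traces in rho = l \sum_i p_i |v_i><w_i| forces v_i and w_i to agree
   in the limit l -> 1.  For the robustness, rho + s w = (1 + s) y with s -> 0
   gives |rho - y| <= 2 s entrywise. *)
Require Import Defs.
From mathcomp Require Import all_boot all_order all_algebra.
From mathcomp Require Import all_classical all_reals all_analysis.
From mathcomp Require Import complex.
From mathcomp Require Import ring lra.

Set Implicit Arguments.
Unset Strict Implicit.
Unset Printing Implicit Defensive.

Import Order.TTheory GRing.Theory Num.Theory.
Import numFieldNormedType.Exports.
Import Normc.

Local Open Scope classical_set_scope.
Local Open Scope ring_scope.
Local Open Scope complex_scope.

(** * Compactness of convex hulls *)

(* The bound is the real dimension 2 m n, plus 1 for the affine condition. *)
Lemma real_affine_dependence (R : realType) m n k (a : 'I_k -> 'M[R[i]]_(m, n)) :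
  (m * n + (m * n + 1) < k)%N ->
  exists u : 'I_k -> R,
    [/\ exists i, 0 < u i, \sum_i u i = 0 & \sum_i (u i)%:C *: a i = 0].
Proof.
move=> ltk.
(* Row i of [B] lists the real parts and the imaginary parts of the entries of [a i], then 1. A
   nonzero vector of its left kernel is the dependence sought. *)
pose coords (f : R[i] -> R) := \matrix_(i < k) mxvec (map_mx f (a i)).
pose B := row_mx (coords (@complex.Re R))
  (row_mx (coords (@complex.Im R)) (const_mx 1 : 'M[R]_(k, 1))).
have : kermx B != 0.
  rewrite -mxrank_eq0 mxrank_ker -lt0n subn_gt0.
  by rewrite (leq_ltn_trans _ ltk)// rank_leq_col.
case/rowV0Pn => v /sub_kermxP vB0 v0; move: vB0.
rewrite !mul_mx_row -[0](@row_mx0 _ _ _ (m * n + 1)) => /eq_row_mx[vRe0].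
rewrite -[0]row_mx0 => /eq_row_mx[vIm0 v10].
exists (fun i => v 0 i).
have sumv0 : \sum_i v 0 i = 0.
  move: v10 => /matrixP/(_ 0 0); rewrite !mxE.
  by under eq_bigr do rewrite mxE mulr1.
have coords0 (f : R[i] -> R) : v *m coords f = 0 ->
    forall j l, \sum_i v 0 i * f (a i j l) = 0.
  move=> /rowP vf0 j l; have := vf0 (mxvec_index j l).
  by rewrite !mxE; under eq_bigr do rewrite mxE mxvecE mxE.
split=> //.
(* Nonpositive coefficients of sum 0 would all vanish, against [v != 0]. *)
- apply: contrapT => /forallNP vle0.
  have {}vle0 i : v 0 i <= 0 by rewrite leNgt; apply/negP/vle0.
  have : \sum_i (- v 0 i) == 0 by rewrite sumrN sumv0 oppr0.
  rewrite psumr_eq0 => [/allP v_eq0|i _]; last by rewrite oppr_ge0.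
  case/negP: v0; apply/eqP/rowP => i; rewrite mxE; apply/eqP.
  by rewrite -oppr_eq0; apply: v_eq0; rewrite mem_index_enum.
- apply/matrixP => j l; rewrite summxE mxE.
  have -> : \sum_i ((v 0 i)%:C *: a i) j l =
      (\sum_i v 0 i * complex.Re (a i j l)) +i*
      (\sum_i v 0 i * complex.Im (a i j l)).
    elim/big_rec3 : _ => // i x y z _ ->; rewrite mxE.
    by case: (a i j l) => p q; simpc.
  by rewrite !coords0.
Qed.

(** The number of terms becomes a parameter, so that it can be brought to a common bound. *)
Definition convex_comb {R : realType} {E : lmodType R[i]} (A : set E) n : set E :=
  [set x | exists (p : 'I_n -> R) (a : 'I_n -> E),
     [/\ forall i, 0 <= p i, forall i, A (a i), \sum_(i < n) p i = 1
       & x = \sum_(i < n) (p i)%:C *: a i]].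

Lemma convex_combS (R : realType) (E : lmodType R[i]) (A : set E) n :
  convex_comb A n `<=` convex_comb A n.+1.
Proof.
case: n => [x [p [a [_ _ /eqP]]]|n x [p [a [p0 Aa p1 ->]]]].
  by rewrite big_ord0 eq_sym oner_eq0.
exists (fun i => if unlift ord0 i is Some j then p j else 0).
(* The added point has weight 0 but must still lie in [A], so a point already present is
   repeated. *)
exists (fun i => if unlift ord0 i is Some j then a j else a ord0).
split=> [i|i||].
- by case: unliftP.
- by case: unliftP.
- rewrite big_ord_recl unlift_none add0r -[RHS]p1.
  by apply: eq_bigr => i _; rewrite liftK.
- rewrite [RHS]big_ord_recl unlift_none scale0r add0r.
  by apply: eq_bigr => i _; rewrite liftK.
Qed.

(** The weights are moved along an affine dependence of the k + 1 points until one of them vanishes;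
    its point is then dropped. *)
Lemma convex_comb_pred (R : realType) m n k (A : set 'M[R[i]]_(m, n)) :
  (m * n + (m * n + 1) <= k)%N -> convex_comb A k.+1 `<=` convex_comb A k.
Proof.
move=> lek x [p [a [p0 Aa p1 ->]]].
have [u [[i1 ui1] u0 ua0]] := real_affine_dependence a lek.
pose t := p i1 / u i1.
(* The minimal ratio is the longest move along [- u] that keeps every weight nonnegative; it brings
   the weight of [i0] to 0. *)
have [i0 ui0 min_i0] := @Order.TotalTheory.arg_minP _ _ _ i1 [pred i | 0 < u i]
  (fun i => p i / u i) ui1.
pose q i := p i - p i0 / u i0 * u i.
have q0 i : 0 <= q i.
  rewrite subr_ge0; have [ui|ui] := ltP 0 (u i).
    by rewrite -ler_pdivlMr// min_i0.
  by apply: le_trans (p0 i); rewrite mulr_ge0_le0// divr_ge0// ltW.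
have qi0 : q i0 = 0 by rewrite /q divfK ?subrr// gt_eqF.
exists (fun j => q (lift i0 j)), (fun j => a (lift i0 j)); split=> //.
- transitivity (\sum_i q i); first by rewrite [RHS](bigD1_ord i0)//= qi0 add0r.
  by rewrite sumrB -mulr_sumr u0 mulr0 subr0.
- transitivity (\sum_i (q i)%:C *: a i).
    under [RHS]eq_bigr do rewrite rmorphB rmorphM scalerBl -scalerA.
    by rewrite sumrB -scaler_sumr ua0 scaler0 subr0.
  by rewrite (bigD1_ord i0)//= qi0 scale0r add0r.
Qed.

(** Short combinations are padded with weights 0 and long ones lose one term at a time. A fixed
    length makes the hull an image of a finite product. *)
Lemma Caratheodory (R : realType) m n (A : set 'M[R[i]]_(m, n)) :
  convex_hull A = convex_comb A (m * n + (m * n + 1)).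
Proof.
apply/seteqP; split=> [x [k]|x Ax]; last by exists (m * n + (m * n + 1))%N.
have [/subnK <-|/ltnW/subnK <-] := leqP k (m * n + (m * n + 1)).
  elim: (_ - k)%N => [//|j IH] /IH; exact: convex_combS.
elim: (k - _)%N => [//|j IH] Ax; apply: IH.
by apply: convex_comb_pred Ax; rewrite leq_addl.
Qed.

(** * Entrywise topology and continuous images *)

(** The entries may lie in any topological space: below they are reals, complex numbers and, for
    families of points, whole matrices. *)
Lemma mx_entry_continuous (T : topologicalType) m n i j :
  continuous (fun M : 'M[T]_(m, n) => M i j).
Proof.
move=> M B nB; exists (fun i' j' => if (i' == i) && (j' == j) then B else setT).
  by move=> i' j'; case: ifP => [/andP[/eqP-> /eqP->]//|_]; exact: filterT.
by move=> N /(_ i j); rewrite !eqxx.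
Qed.

Lemma mx_continuous (S T : topologicalType) m n (f : S -> 'M[T]_(m, n)) :
  (forall i j, continuous (fun x => f x i j)) -> continuous f.
Proof.
move=> cf x B [P /= nP PB].
have : \forall y \near x, forall ij : 'I_m * 'I_n, P ij.1 ij.2 (f y ij.1 ij.2).
  apply: filter_forall => -[i j] /=; exact: cf (nP i j).
by apply: filterS => y Py; apply: PB => i j; exact: Py (i, j).
Qed.

Lemma real_complex_continuous (R : realType) :
  continuous (fun r : R => r%:C : R[i]).
Proof.
(* A positive radius in [R[i]] has imaginary part 0, so the estimate reduces to one about reals. *)
move=> r; apply/cvgrPdist_lt => /= e; rewrite ltcE/= => /andP[/eqP Ime Ree].
near=> s.
rewrite -rmorphB normc_def /= expr0n /= addr0 sqrtr_sqr ltcE /= Ime eqxx /=.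
near: s; exact: cvgr_dist_lt.
Unshelve. all: by end_near. Qed.

Lemma conj_continuous (R : realType) : continuous (fun z : R[i] => z^*%R).
Proof.
move=> z B /nbhs_ballP[e /= e0 eB]; apply/nbhs_ballP; exists e => //= w zw.
apply: eB; move: zw; rewrite -!ball_normE /ball_/= -rmorphB.
by rewrite norm_conjC.
Qed.

(** Weights in a cube and points in a power of [A] form a compact set; the hull is the continuous
    image of its closed part where the weights sum to 1. *)
Lemma convex_hull_compact (R : realType) m n (A : set 'M[R[i]]_(m, n)) :
  compact A -> compact (convex_hull A).
Proof.
move=> cA; set N := (m * n + (m * n + 1))%N.
pose E := 'M[R[i]]_(m, n).
pose T := ('rV[R]_N * 'rV[E]_N)%type.
pose K := [set p : 'rV[R]_N | forall i, `[0, 1]%classic (p ord0 i)] `*`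
  [set a : 'rV[E]_N | forall i, A (a ord0 i)].
pose wsum (z : T) := \sum_i z.1 ord0 i.
pose comb (z : T) := \sum_i (z.1 ord0 i)%:C *: z.2 ord0 i.
have weight_cont i : continuous (fun z : T => z.1 ord0 i).
  move=> z; apply: (@continuous_comp _ _ _ fst (fun p : 'rV[R]_N => p ord0 i)).
    exact: cvg_fst.
  exact: mx_entry_continuous.
have point_cont i : continuous (fun z : T => z.2 ord0 i).
  move=> z; apply: (@continuous_comp _ _ _ snd (fun a : 'rV[E]_N => a ord0 i)).
    exact: cvg_snd.
  exact: mx_entry_continuous.
have wsum_cont : continuous wsum.
  by apply: continuous_big => //; exact: add_continuous.
have comb_cont : continuous comb.
  apply: continuous_big => [|i _]; first exact: add_continuous.
  move=> z.
  apply: (@cvgZ _ _ T (nbhs z) _ (fun z : T => (z.1 ord0 i)%:C)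
    (fun z : T => z.2 ord0 i)); last exact: point_cont.
  apply: (@continuous_comp _ _ _ (fun z : T => z.1 ord0 i) (fun r => r%:C)).
    exact: weight_cont.
  exact: real_complex_continuous.
have -> : convex_hull A = comb @` (K `&` wsum @^-1` [set 1]).
  rewrite Caratheodory -/N; apply/seteqP.
  split=> [x [p [a [p0 Aa p1 ->]]]|_ [[p a] [/= [Kp Ka] p1] <-]].
    exists (\row_i p i, \row_i a i); last first.
      by apply: eq_bigr => i _; rewrite !mxE.
    split; last by rewrite /= -p1; apply: eq_bigr => i _; rewrite mxE.
    (* Nonnegative weights of sum 1 are at most 1, so the cube contains them. *)
    split=> i; rewrite /= mxE// in_itv /= p0 -p1 (bigD1 i)//= lerDl.
    by rewrite sumr_ge0.
  exists (fun i => p ord0 i), (fun i => a ord0 i).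
  by split=> // i; have := Kp i; rewrite /= in_itv/= => /andP[].
apply: continuous_compact; first exact: continuous_subspaceT.
apply: compact_closedI; last first.
  apply: closed_comp => [z _|]; [exact: wsum_cont|exact: closed_eq].
apply: compact_setX.
  apply: (@rV_compact R N (fun=> `[0, 1]%classic)) => _.
  exact: segment_compact.
by apply: (@rV_compact E N (fun=> A)).
Qed.

Lemma ketbra_continuous (R : realType) d :
  continuous (fun v : 'cV[R[i]]_d => ketbra v v).
Proof.
apply: mx_continuous => i j.
have -> : (fun v : 'cV[R[i]]_d => ketbra v v i j) = (fun v => v i 0 * (v j 0)^*).
  by apply/funext => v; rewrite !mxE big_ord1 !mxE.
move=> v; apply: (@cvgM _ _ (nbhs v) _ (fun v : 'cV[R[i]]_d => v i 0)
  (fun v : 'cV[R[i]]_d => (v j 0)^*)); first exact: mx_entry_continuous.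
apply: (@continuous_comp _ _ _ (fun v : 'cV[R[i]]_d => v j 0) Num.conj).
  exact: mx_entry_continuous.
exact: conj_continuous.
Qed.

Lemma hull_Splus_closed (R : realType) d (V : set 'cV[R[i]]_d) :
  compact V -> closed (convex_hull (Splus V)).
Proof.
move=> cV; apply: compact_closed; first exact: norm_hausdorff.
apply: convex_hull_compact; apply: continuous_compact => //.
exact/continuous_subspaceT/ketbra_continuous.
Qed.

(** Balls of matrices are products of balls of entries. Both approximation arguments below conclude
    through this form of closedness. *)
Lemma closed_entrywise (R : realType) m n (A : set 'M[R[i]]_(m, n))
    (x : 'M[R[i]]_(m, n)) : closed A ->
  (forall e : R, 0 < e ->
    exists2 y, A y & forall j k, normc (x j k - y j k) < e) ->
  A x.
Proof.
move=> cA Ax; apply: cA => B /nbhs_ballP[e /= e0 eB].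
move: e0; rewrite ltcE/= => /andP[/eqP Ime Ree].
have [y Ay xy] := Ax _ Ree; exists y; split=> //; apply: eB; split=> [|j k].
  by rewrite ltcE/= Ime eqxx.
rewrite -ball_normE /ball_/=.
by rewrite [e]complexE Ime mulr0 addr0 ltcR; exact: xy.
Qed.

(** * Rank-one operators and density matrices *)

Lemma normc_ge0 (R : rcfType) (z : R[i]) : 0 <= normc z.
Proof. by case: z => a b /=; exact: sqrtr_ge0. Qed.

Lemma sqr_normc_ReIm (R : rcfType) (z : R[i]) :
  normc z ^+ 2 = complex.Re z ^+ 2 + complex.Im z ^+ 2.
Proof. by case: z => a b /=; rewrite sqr_sqrtr// addr_ge0 ?sqr_ge0. Qed.

Lemma sqr_normcB (R : realType) (z w : R[i]) :
  normc (z - w) ^+ 2 = normc z ^+ 2 + normc w ^+ 2 - 2 * complex.Re (w * z^*%R).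
Proof. by rewrite !sqr_normc_ReIm; case: z w => a b [c e] /=; ring. Qed.

Lemma normc_real (R : rcfType) (r : R) : 0 <= r -> normc r%:C = r.
Proof. by move=> r0; rewrite /= expr0n addr0 sqrtr_sqr ger0_norm. Qed.

Lemma normc_conj (R : realType) (z : R[i]) : normc z^*%R = normc z.
Proof. by case: z => a b /=; rewrite sqrrN. Qed.

Lemma le_normc_sum (R : rcfType) n (F : 'I_n -> R[i]) :
  normc (\sum_i F i) <= \sum_i normc (F i).
Proof.
elim/big_rec2 : _ => [|i x y _ yx]; first by rewrite normc0.
by apply: le_trans (le_normcD _ _) _; rewrite lerD2l.
Qed.

Lemma Re_realM (R : realType) (r : R) (z : R[i]) :
  complex.Re (r%:C * z) = r * complex.Re z.
Proof. by case: z => a b /=; rewrite mul0r subr0. Qed.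

Lemma Re_sum (R : realType) n (F : 'I_n -> R[i]) :
  complex.Re (\sum_i F i) = \sum_i complex.Re (F i).
Proof. by elim/big_rec2 : _ => // i r z _ <-; case: (F i) z => a b []. Qed.

Section ketbra.
Context {R : realType} {d : nat}.
Implicit Types v w : 'cV[R[i]]_d.

Lemma ketbraE v w j k : ketbra v w j k = v j 0 * (w k 0)^*%R.
Proof. by rewrite !mxE big_ord1 !mxE. Qed.

Lemma mxtrace_ketbra v w : \tr (ketbra v w) = \sum_j v j 0 * (w j 0)^*%R.
Proof. by apply: eq_bigr => j _; rewrite ketbraE. Qed.

Lemma unit_vectorE v : unit_vector v <-> \sum_j v j 0 * (v j 0)^*%R = 1.
Proof.
rewrite /unit_vector mxE.
by under eq_bigr do rewrite !mxE mulrC.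
Qed.

Lemma mxtrace_ketbra_unit v : unit_vector v -> \tr (ketbra v v) = 1.
Proof. by move=> /unit_vectorE; rewrite mxtrace_ketbra. Qed.

Lemma unit_vector_sqr v : unit_vector v -> \sum_j normc (v j 0) ^+ 2 = 1.
Proof.
move=> /unit_vectorE /(congr1 (@complex.Re R)); rewrite Re_sum /= => <-.
apply: eq_bigr => j _; rewrite sqr_normc_ReIm.
by case: (v j 0) => a b /=; rewrite mulrN opprK -!expr2.
Qed.

Lemma unit_vector_entry_le1 v j : unit_vector v -> normc (v j 0) <= 1.
Proof.
move=> /unit_vector_sqr v1; rewrite -(@expr_le1 _ 2)// ?normc_ge0//.
by rewrite -v1 (bigD1 j)//= lerDl sumr_ge0// => k _; exact: sqr_ge0.
Qed.

Lemma ketbra_entry_le1 v w j k :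
  unit_vector v -> unit_vector w -> normc (ketbra v w j k) <= 1.
Proof.
move=> v1 w1; rewrite ketbraE normcM normc_conj mulr_ile1 ?normc_ge0//;
exact: unit_vector_entry_le1.
Qed.

(** The trace of |v><w| is the inner product <w, v>, so this is the expansion of |w - v|^2. *)
Lemma sqr_dist_unit v w : unit_vector v -> unit_vector w ->
  \sum_j normc (w j 0 - v j 0) ^+ 2 = 2 - 2 * complex.Re (\tr (ketbra v w)).
Proof.
move=> /unit_vector_sqr v1 /unit_vector_sqr w1.
under eq_bigr do rewrite sqr_normcB.
rewrite sumrB big_split/= v1 w1 -mulr_sumr mxtrace_ketbra Re_sum.
by congr (_ - _); ring.
Qed.

(** Cauchy-Schwarz for unit vectors, in the form |w - v|^2 >= 0. *)
Lemma Re_mxtrace_ketbra_le1 v w : unit_vector v -> unit_vector w ->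
  complex.Re (\tr (ketbra v w)) <= 1.
Proof.
move=> v1 w1; have : 0 <= 2 - 2 * complex.Re (\tr (ketbra v w)).
  by rewrite -sqr_dist_unit// sumr_ge0// => j _; exact: sqr_ge0.
lra.
Qed.

(** The difference is |v><w - v|, and |v_j| <= 1. A trace close to 1 thus forces |v><w| to be close
    to |v><v|. *)
Lemma ketbra_diag_dist v w j k : unit_vector v -> unit_vector w ->
  normc (ketbra v w j k - ketbra v v j k) ^+ 2
  <= 2 - 2 * complex.Re (\tr (ketbra v w)).
Proof.
move=> v1 w1; rewrite !ketbraE -mulrBr -rmorphB normcM normc_conj exprMn.
rewrite -sqr_dist_unit// (bigD1 k)//=; apply: ler_wpDr.
  by rewrite sumr_ge0// => l _; exact: sqr_ge0.
rewrite ler_piMl ?sqr_ge0// expr_le1 ?normc_ge0//.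
exact: unit_vector_entry_le1.
Qed.

End ketbra.

Lemma convex_hull_sub (R : realType) (E : lmodType R[i]) (A : set E) :
  A `<=` convex_hull A.
Proof.
move=> x Ax; exists 1%N, (fun=> 1), (fun=> x).
by split=> //; rewrite big_ord1 ?scale1r.
Qed.

Lemma convex_hull_mono (R : realType) (E : lmodType R[i]) (A B : set E) :
  A `<=` B -> convex_hull A `<=` convex_hull B.
Proof.
by move=> AB x [n [p [a [p0 Aa p1 ->]]]]; exists n, p, a; split=> // i; exact: AB.
Qed.

Lemma convex_hull_mxtrace (R : realType) d (A : set 'M[R[i]]_d) x :
  (forall a, A a -> \tr a = 1) -> convex_hull A x -> \tr x = 1.
Proof.
move=> A1 [n [p [a [p0 Aa p1 ->]]]]; rewrite linear_sum/=.
under eq_bigr do rewrite linearZ/= A1// mulr1.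
by rewrite -rmorph_sum p1.
Qed.

Lemma convex_hull_entry_le1 (R : realType) m n (A : set 'M[R[i]]_(m, n)) x j k :
  (forall a, A a -> normc (a j k) <= 1) -> convex_hull A x ->
  normc (x j k) <= 1.
Proof.
move=> A1 [l [p [a [p0 Aa p1 ->]]]]; rewrite summxE.
apply: le_trans (le_normc_sum _) _; rewrite -p1; apply: ler_sum => i _.
by rewrite mxE normcM normc_real// ler_piMr// A1.
Qed.

(** * Entry bounds for density matrices *)

Section density.
Local Open Scope sesquilinear_scope.

(** The vectors e_j + c e_k probe only the rows and columns j and k: c = 0 isolates a diagonal
    entry, and a phase c reaches an off-diagonal one. *)
Lemma sesquilinear_form_delta (R : realType) d (w : 'M[R[i]]_d) j k (c : R[i]) :
  let v : 'cV_d := delta_mx j 0 + c *: delta_mx k 0 in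
  (v^t* *m w *m v) 0 0 = w j j + c * w j k + c^*%R * w k j + c^*%R * c * w k k.
Proof.
move=> v.
have -> : v^t* = delta_mx 0 j + c^*%R *: delta_mx 0 k.
  by rewrite /v linearD linearZ/= map_mxD map_mxZ !trmx_delta !map_delta_mx.
rewrite mulmxDl -scalemxAl -!rowE mulmxDr -scalemxAr -!colE !mxE.
ring.
Qed.

Lemma density_diag_le1 (R : realType) d (w : 'M[R[i]]_d) j :
  density_matrix w -> 0 <= complex.Re (w j j) <= 1.
Proof.
case=> _ w0 w1.
have w_diag k : 0 <= complex.Re (w k k).
  have := w0 (delta_mx k 0 + 0 *: delta_mx k 0).
  rewrite sesquilinear_form_delta conjC0 !mul0r !addr0 lecE.
  by case/andP.
rewrite w_diag -[leRHS]/(complex.Re 1) -w1 Re_sum (bigD1 j)//= lerDl.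
exact: sumr_ge0.
Qed.

(** Positivity at e_j + c e_k, for a suitable phase c, gives 2 |w_jk| <= w_jj + w_kk <= 2. *)
Lemma density_entry_le1 (R : realType) d (w : 'M[R[i]]_d) j k :
  density_matrix w -> normc (w j k) <= 1.
Proof.
move=> dw; case: (dw) => /is_hermitianmxP wH w0 _.
have wkj : w k j = (w j k)^*%R by rewrite {1}wH expr0 scale1r !mxE.
(* The phase chosen below divides by |w_jk|, so a zero entry is set apart. *)
have [z0|z0] := eqVneq (w j k) 0; first by rewrite z0 normc0.
set z := w j k in z0 wkj *.
have nz0 : `|z| != 0 by rewrite normr_eq0.
(* The phase that turns the cross terms of the quadratic form into - 2 |z| *)
pose c := - z^*%R / `|z|.
have cz : c * z = - `|z|.
  by rewrite /c mulrAC mulNr (mulrC z^*%R) -normCK expr2 mulNr mulfK.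
have czJ : c^*%R * z^*%R = - `|z|.
  by rewrite -rmorphM cz rmorphN/= conj_normC.
have cc : c^*%R * c = 1.
  rewrite mulrC -normCK normrM normrN normfV norm_conjC normr_id.
  by rewrite divff// expr1n.
have := w0 (delta_mx j 0 + c *: delta_mx k 0).
rewrite sesquilinear_form_delta wkj -/z cz czJ cc mul1r lecE => /andP[_].
have -> : complex.Re (w j j + - `|z| + - `|z| + w k k) =
    complex.Re (w j j) - 2 * normc z + complex.Re (w k k).
  have -> : `|z| = (normc z)%:C by [].
  by case: (w j j) (w k k) => a b [e f] /=; ring.
have /andP[_ ?] := density_diag_le1 j dw.
have /andP[_ ?] := density_diag_le1 k dw.
rewrite /=; lra.
Qed.
End density.

(** * Gauges *)

Section conic_sum.
Context {R : realType} {E : lmodType R[i]}.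
Implicit Types (A : set E) (x y : E) (r s : R).

(** An unnormalised form of [dilate r (convex_hull A)]: only the total weight is recorded, so that
    sums and nonnegative multiples need no division. *)
Definition conic_sum A r x : Prop :=
  exists (n : nat) (c : 'I_n -> R) (a : 'I_n -> E),
    [/\ forall i, 0 <= c i, forall i, A (a i), \sum_i c i = r
      & x = \sum_i (c i)%:C *: a i].

(** Arbitrary finite index types let disjoint unions and pairs of indices be used directly. *)
Lemma conic_sum_fin A (I : finType) (c : I -> R) (a : I -> E) :
  (forall i, 0 <= c i) -> (forall i, A (a i)) ->
  conic_sum A (\sum_i c i) (\sum_i (c i)%:C *: a i).
Proof.
move=> c0 Aa; exists #|I|, (fun i => c (enum_val i)), (fun i => a (enum_val i)).
by split=> //; rewrite (reindex _ (onW_bij _ (enum_val_bij I))).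
Qed.

Lemma dilate_conic_sum A r x : 0 <= r -> dilate r (convex_hull A) x ->
  conic_sum A r x.
Proof.
move=> r0 [_ [n [p [a [p0 Aa p1 ->]]]] <-].
exists n, (fun i => r * p i), a; split=> // [i||].
- exact: mulr_ge0.
- by rewrite -mulr_sumr p1 mulr1.
- by rewrite scaler_sumr; apply: eq_bigr => i _; rewrite rmorphM scalerA.
Qed.

(** The weights are divided by r, hence r > 0: for empty [A] the empty sum has weight 0 while the
    hull has no point. *)
Lemma conic_sum_dilate A r x : 0 < r -> conic_sum A r x ->
  dilate r (convex_hull A) x.
Proof.
move=> r0 [n [c [a [c0 Aa cr ->]]]].
exists (\sum_i (c i / r)%:C *: a i).
  exists n, (fun i => c i / r), a; split=> // [i|].
    by rewrite divr_ge0// ltW.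
  by rewrite -mulr_suml cr divff// gt_eqF.
rewrite scaler_sumr; apply: eq_bigr => i _.
by rewrite scalerA -rmorphM mulrC divfK// gt_eqF.
Qed.

Lemma conic_sum0 A : conic_sum A 0 0.
Proof.
by exists 0%N, (fun=> 0), (fun=> 0); split=> [[]|[]||]//; rewrite big_ord0.
Qed.

Lemma conic_sumD A r s x y : conic_sum A r x -> conic_sum A s y ->
  conic_sum A (r + s) (x + y).
Proof.
move=> [n [c [a [c0 Aa <- ->]]]] [m [e [b [e0 Ab <- ->]]]].
have := @conic_sum_fin A ('I_n + 'I_m)%type
  (fun i => match i with inl i => c i | inr j => e j end)
  (fun i => match i with inl i => a i | inr j => b j end).
by rewrite !big_sumType/=; apply; case.
Qed.

Lemma conic_sum_sum A n (r : 'I_n -> R) (x : 'I_n -> E) :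
  (forall i, conic_sum A (r i) (x i)) -> conic_sum A (\sum_i r i) (\sum_i x i).
Proof.
move=> rx; elim/big_rec2 : _ => [|i s y _ ys]; first exact: conic_sum0.
exact: conic_sumD.
Qed.

Lemma conic_sumZ A t r x : 0 <= t -> conic_sum A r x ->
  conic_sum A (t * r) (t%:C *: x).
Proof.
move=> t0 [n [c [a [c0 Aa <- ->]]]]; exists n, (fun i => t * c i), a.
split=> // [i||]; [exact: mulr_ge0|by rewrite mulr_sumr|].
by rewrite scaler_sumr; apply: eq_bigr => i _; rewrite rmorphM scalerA.
Qed.

End conic_sum.

Section gauge.
Context {R : realType} {E : lmodType R[i]}.
Implicit Types (A : set E) (x : E).

Lemma atomic_gauge_le A l x : 0 <= l -> dilate l (convex_hull A) x ->
  (atomic_gauge A x <= l%:E)%E.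
Proof. by move=> l0 Ax; apply: ereal_inf_lbound; exists l. Qed.

Lemma atomic_gauge_ge0 A x : (0 <= atomic_gauge A x)%E.
Proof. by apply: le_ereal_inf_tmp => _ [l [l0 _] <-]; rewrite lee_fin. Qed.

Lemma atomic_gauge_lt A x (r : R) : (atomic_gauge A x < r%:E)%E ->
  exists l, [/\ 0 <= l, l < r & dilate l (convex_hull A) x].
Proof.
by move=> /ereal_inf_lt[_ [l [l0 Ax] <-]]; rewrite lte_fin => lr; exists l.
Qed.

Lemma atomic_gauge_mono A B x : A `<=` B ->
  (atomic_gauge B x <= atomic_gauge A x)%E.
Proof.
move=> AB; apply: ereal_inf_le_tmp => _ [l [l0 [a Aa <-]] <-].
by exists l => //; split=> //; exists a => //; exact: convex_hull_mono Aa.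
Qed.

Lemma convex_hull_gauge_le1 A x : convex_hull A x -> (atomic_gauge A x <= 1)%E.
Proof.
by move=> Ax; apply: atomic_gauge_le => //; exists x => //; rewrite scale1r.
Qed.

End gauge.

Lemma Re_mxtrace_sum (R : realType) d n (c : 'I_n -> R) (a : 'I_n -> 'M[R[i]]_d) :
  complex.Re (\tr (\sum_i (c i)%:C *: a i)) =
  \sum_i c i * complex.Re (\tr (a i)).
Proof.
rewrite (linear_sum (@mxtrace _ d)) Re_sum.
by apply: eq_bigr => i _; rewrite linearZ/= Re_realM.
Qed.

(** * Atomic gauges of matrices of trace 1 *)

Section states.
Context {R : realType} {d : nat} (V : set 'cV[R[i]]_d)
  (V_unit : forall v, V v -> unit_vector v).
Implicit Types rho : 'M[R[i]]_d.

Lemma Splus_sub_Sket : Splus V `<=` Sket V.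
Proof. by move=> _ [v Vv <-]; exists v => //; exists v. Qed.

Lemma Splus_mxtrace a : Splus V a -> \tr a = 1.
Proof. by move=> [v /V_unit v1 <-]; exact: mxtrace_ketbra_unit. Qed.

Lemma Sket_entry_le1 a j k : Sket V a -> normc (a j k) <= 1.
Proof. by move=> [v /V_unit v1 [w /V_unit w1 <-]]; exact: ketbra_entry_le1. Qed.

(** Each atom |v><w| has a trace of real part at most 1. This is the source of the lower bound 1 on
    the gauges and on the convex roof. *)
Lemma conic_sum_Sket_mxtrace r rho : conic_sum (Sket V) r rho ->
  complex.Re (\tr rho) <= r.
Proof.
move=> [n [c [a [c0 Sa <- ->]]]]; rewrite Re_mxtrace_sum.
apply: ler_sum => i _; rewrite ler_piMr//.
by have [v /V_unit v1 [w /V_unit w1 <-]] := Sa i; exact: Re_mxtrace_ketbra_le1.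
Qed.

Lemma gauge_Sket_ge1 rho : \tr rho = 1 -> (1 <= atomic_gauge (Sket V) rho)%E.
Proof.
move=> rho1; apply: le_ereal_inf_tmp => _ [l [l0 Srho] <-]; rewrite lee_fin.
have := conic_sum_Sket_mxtrace (dilate_conic_sum l0 Srho).
by rewrite rho1.
Qed.

Context (V_compact : compact V).

(* If rho = l \sum_i p_i |v_i><w_i|, then \sum_i p_i |v_i - w_i|^2 is
   2 (1 - 1/l), so \sum_i p_i |v_i><v_i| tends to rho as l tends to 1. *)
Lemma gauge_Sket_hull rho : \tr rho = 1 ->
  (atomic_gauge (Sket V) rho <= 1)%E -> convex_hull (Splus V) rho.
Proof.
move=> rho1 gauge1; apply: closed_entrywise; first exact: hull_Splus_closed.
(* The final bound is (l - 1) (1 + 1/e) + e/2; [t] is chosen so that l - 1 < t makes it less than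
   e. *)
move=> e e0; pose t := e / 2 / (1 + e^-1).
have e1_gt0 : 0 < 1 + e^-1 by rewrite addr_gt0// invr_gt0.
have t0 : 0 < t by rewrite !divr_gt0.
have /atomic_gauge_lt[l [l0 lt [x Sx rhoE]]] :
    (atomic_gauge (Sket V) rho < (1 + t)%:E)%E.
  by rewrite (le_lt_trans gauge1)// lte_fin ltrDl.
have l1 : 1 <= l.
  have := conic_sum_Sket_mxtrace (dilate_conic_sum l0 (ex_intro2 _ _ x Sx rhoE)).
  by rewrite rho1.
have l_neq0 : l != 0 by rewrite gt_eqF// (lt_le_trans _ l1).
have [n [p [a [p0 Sa p1 xE]]]] := Sx.
have vP i : exists v, V v /\ exists2 w, V w & a i = ketbra v w.
  by have [v Vv [w Vw <-]] := Sa i; exists v; split=> //; exists w.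
have [v {}vP] := choice vP.
pose y := \sum_i (p i)%:C *: ketbra (v i) (v i).
exists y.
  exists n, p, (fun i => ketbra (v i) (v i)); split=> // i.
  by exists (v i) => //; case: (vP i).
move=> j k.
have -> : rho j k - y j k = (l - 1)%:C * x j k + (x j k - y j k).
  by rewrite -rhoE mxE rmorphB/=; ring.
apply: le_lt_trans (le_normcD _ _) _.
rewrite normcM normc_real ?subr_ge0//.
have x_le1 : normc (x j k) <= 1.
  by apply: convex_hull_entry_le1 Sx => b; exact: Sket_entry_le1.
(* Taking traces in rho = l x shows that the p-average of Re tr (a i) is 1/l. *)
have Retr : l * \sum_i p i * complex.Re (\tr (a i)) = 1.
  have := congr1 (@complex.Re R) rho1.
  by rewrite -rhoE xE mxtraceZ Re_realM Re_mxtrace_sum.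
have xy : normc (x j k - y j k) <= e / 2 + e^-1 * (1 - l^-1).
  rewrite xE !summxE -sumrB; apply: le_trans (le_normc_sum _) _.
  (* The bound is rewritten as a p-average, which reduces the estimate to one on each atom. *)
  have -> : e / 2 + e^-1 * (1 - l^-1) =
      \sum_i p i * (e / 2 + e^-1 * (1 - complex.Re (\tr (a i)))).
    under eq_bigr do rewrite mulrDr (mulrCA _ e^-1) mulrBr mulr1.
    rewrite big_split/= -mulr_suml p1 mul1r -mulr_sumr sumrB p1.
    congr (_ + _ * (_ - _)); apply: (mulfI l_neq0).
    by rewrite Retr divff.
  apply: ler_sum => i _; rewrite [((p i)%:C *: a i) j k]mxE
    [(_ *: ketbra _ _) j k]mxE -mulrBr normcM normc_real//.
  apply: ler_wpM2l => //.
  have [Vv [w Vw aE]] := vP i; rewrite aE.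
  have := ketbra_diag_dist j k (V_unit Vv) (V_unit Vw).
  set q := normc _; set T := complex.Re _ => qT.
  (* AM-GM: 2 q <= e + q^2 / e *)
  have : 0 <= e^-1 * (q - e) ^+ 2 by rewrite mulr_ge0 ?invr_ge0 ?sqr_ge0 ?ltW.
  have -> : e^-1 * (q - e) ^+ 2 = e^-1 * q ^+ 2 - 2 * q + e.
    by field; rewrite gt_eqF.
  have : e^-1 * q ^+ 2 <= e^-1 * (2 - 2 * T) by rewrite ler_wpM2l// invr_ge0 ltW.
  lra.
have lV : 1 - l^-1 <= l - 1.
  have : 0 <= (l - 1) ^+ 2 / l by rewrite divr_ge0// sqr_ge0.
  have -> : (l - 1) ^+ 2 / l = l - 2 + l^-1 by field.
  lra.
have : (l - 1) * normc (x j k) <= l - 1 by rewrite ler_piMr// subr_ge0.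
have : e^-1 * (1 - l^-1) <= e^-1 * (l - 1) by rewrite ler_wpM2l// invr_ge0 ltW.
have : (l - 1) * (1 + e^-1) < e / 2 by rewrite -ltr_pdivlMr// ltrBlDl.
lra.
Qed.

(** The gauge decreases as atoms are added, so that of [A] is squeezed between those of [Sket V] and
    [Splus V]. All three atomic gauges are instances. *)
Lemma gauge_eq1 A rho : \tr rho = 1 -> Splus V `<=` A -> A `<=` Sket V ->
  atomic_gauge A rho = 1%E <-> convex_hull (Splus V) rho.
Proof.
move=> rho1 SA AS; split=> [A1|Srho].
  by apply: gauge_Sket_hull => //; rewrite -A1 atomic_gauge_mono.
apply/eqP; rewrite eq_le; apply/andP; split.
  by apply: convex_hull_gauge_le1; exact: convex_hull_mono Srho.
by apply: le_trans (atomic_gauge_mono rho AS); exact: gauge_Sket_ge1.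
Qed.

End states.

(** * Convex roof and robustness *)

(** The double sum has total weight (sum_i c_i)^2, which matches the square of the gauge in the
    convex roof. *)
Lemma conic_sum_ketbra (R : realType) d (V : set 'cV[R[i]]_d) l psi :
  conic_sum V l psi -> conic_sum (Sket V) (l ^+ 2) (ketbra psi psi).
Proof.
move=> [n [c [a [c0 Va <- ->]]]].
have := @conic_sum_fin R 'M[R[i]]_d (Sket V) ('I_n * 'I_n)%type
  (fun ij => c ij.1 * c ij.2) (fun ij => ketbra (a ij.1) (a ij.2)).
have -> : \sum_ij c ij.1 * c ij.2 = (\sum_i c i) ^+ 2.
  rewrite -(pair_bigA _ (fun i j => c i * c j))/= expr2 mulr_suml.
  by apply: eq_bigr => i _; rewrite mulr_sumr.
have -> : \sum_ij (c ij.1 * c ij.2)%:C *: ketbra (a ij.1) (a ij.2) =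
    ketbra (\sum_i (c i)%:C *: a i) (\sum_i (c i)%:C *: a i).
  rewrite -(pair_bigA _ (fun i j => (c i * c j)%:C *: ketbra (a i) (a j)))/=.
  apply/matrixP => j k; rewrite ketbraE !summxE rmorph_sum mulr_suml.
  apply: eq_bigr => i _; rewrite summxE mulr_sumr; apply: eq_bigr => i' _.
  have cJ (r : R) : (r%:C)^*%R = r%:C by exact: conjc_real.
  rewrite mxE ketbraE [(_ *: a i) _ _]mxE [(_ *: a i') _ _]mxE !rmorphM/= cJ.
  by ring.
apply=> [[i j]|[i j]] /=; first exact: mulr_ge0.
by exists (a i) => //; exists (a j).
Qed.

Section faithfulness.
Context {R : realType} {d : nat} (V : set 'cV[R[i]]_d)
  (V_unit : forall v, V v -> unit_vector v).
Implicit Types rho : 'M[R[i]]_d.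

Lemma gauge_Sket_le_roof rho : \tr rho = 1 ->
  (atomic_gauge (Sket V) rho <= convex_roof V rho)%E.
Proof.
move=> rho1; apply: le_ereal_inf_tmp => _ [n [p [psi [p0 _ p1 rhoE ->]]]].
set G := fun i => atomic_gauge V (psi i).
have term_ge0 i : (0 <= (p i)%:E * G i ^+ 2)%E.
  by rewrite mule_ge0 ?lee_fin// expe_ge0// atomic_gauge_ge0.
(* An infinite gauge with positive weight makes the roof sum infinite; otherwise infinite gauges
   carry weight 0. *)
have [[i [pi0 Gi]]|nGy] := pselect (exists i, 0 < p i /\ G i = +oo%E).
  rewrite (bigD1 i)//= -/(G i) Gi. rewrite mulyy gt0_muley ?lte_fin//.
  by rewrite addye ?leey// gt_eqF// (lt_le_trans _ (sume_ge0 _ _)) ?ltNyr.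
apply/lee_addgt0Pr => e e0.
(* An excess of [p i * e] is allowed in term i, which adds up to e. *)
have decomp i : exists r, (r%:E <= (p i)%:E * G i ^+ 2 + (p i * e)%:E)%E /\
    conic_sum (Sket V) r ((p i)%:C *: ketbra (psi i) (psi i)).
  have [pi0|pi0] := eqVneq (p i) 0.
    (* The gauge may be infinite here; the term is 0 by the convention 0 * +oo = 0. *)
    exists 0; rewrite pi0 mul0e mul0r adde0 scale0r; split=> //.
    exact: conic_sum0.
  have {}pi0 : 0 < p i by rewrite lt_neqAle eq_sym pi0 p0.
  have := atomic_gauge_ge0 V (psi i); rewrite -/(G i).
  case GE : (G i) => [g| |] //; last by case: nGy; exists i.
  rewrite lee_fin => g0.
  have ge0 : 0 <= g ^+ 2 + e by rewrite addr_ge0 ?sqr_ge0 ?ltW.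
  (* The threshold is chosen so that its square exceeds g^2 by exactly e. *)
  have /atomic_gauge_lt[l [l0 lt Vpsi]] : (G i < (Num.sqrt (g ^+ 2 + e))%:E)%E.
    rewrite GE lte_fin -(@ltr_pXn2r _ 2)// ?nnegrE ?sqrtr_ge0//.
    by rewrite sqr_sqrtr// ltrDl.
  exists (p i * l ^+ 2); split; last first.
    apply: conic_sumZ => //; apply: conic_sum_ketbra; exact: dilate_conic_sum.
  rewrite -EFin_expe -EFinM -EFinD lee_fin -mulrDr ler_pM2l//.
  by rewrite -[leRHS]sqr_sqrtr// ler_pXn2r ?nnegrE ?sqrtr_ge0// ltW.
have [r /all_and2[rG Sr]] := choice decomp.
have Srho : conic_sum (Sket V) (\sum_i r i) rho.
  by rewrite rhoE; exact: conic_sum_sum.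
(* The total weight is at least the trace 1, so it can be normalised. *)
have r1 : 0 < \sum_i r i.
  rewrite (lt_le_trans ltr01)//.
  by have := conic_sum_Sket_mxtrace V_unit Srho; rewrite rho1.
apply: le_trans (atomic_gauge_le (ltW r1) (conic_sum_dilate r1 Srho)) _.
have -> : e%:E = (\sum_i (p i * e)%:E)%E by rewrite sumEFin -mulr_suml p1 mul1r.
by rewrite -big_split/= -sumEFin lee_sum.
Qed.

(** A decomposition into kets of [V] is admissible in the roof, and each of these kets has gauge at
    most 1. *)
Lemma convex_hull_roof_le1 rho : convex_hull (Splus V) rho ->
  (convex_roof V rho <= 1)%E.
Proof.
move=> [n [p [a [p0 Sa p1 rhoE]]]].
have aP i : exists v, V v /\ a i = ketbra v v.
  by have [v Vv <-] := Sa i; exists v.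
have [v vP] := choice aP.
apply: (@le_trans _ _ (\sum_(i < n) (p i)%:E * atomic_gauge V (v i) ^+ 2)%E).
  apply: ereal_inf_lbound; exists n, p, v; split=> // [i|].
    by apply: V_unit; case: (vP i).
  by rewrite rhoE; apply: eq_bigr => i _; case: (vP i) => _ ->.
rewrite -p1 -sumEFin; apply: lee_sum => i _.
rewrite -[leRHS]mule1 lee_wpmul2l ?lee_fin// expe2.
rewrite -[leRHS]mule1 lee_pmul ?atomic_gauge_ge0//;
by apply: convex_hull_gauge_le1; apply: convex_hull_sub; case: (vP i).
Qed.

Context (V_compact : compact V).

Lemma roof_eq1 rho : \tr rho = 1 ->
  convex_roof V rho = 1%E <-> convex_hull (Splus V) rho.
Proof.
move=> rho1; split=> [roof1|Srho].
  by apply: gauge_Sket_hull => //; rewrite -roof1 gauge_Sket_le_roof.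
apply/eqP; rewrite eq_le convex_hull_roof_le1//=.
by apply: le_trans (gauge_Sket_le_roof rho1); exact: gauge_Sket_ge1.
Qed.

(** The value s = 0 is attained, with rho itself as the required point of the hull of [X]. *)
Lemma convex_hull_robustness X rho :
  convex_hull X rho -> convex_hull (Splus V) rho ->
  robustness X (Splus V) rho = 0%E.
Proof.
move=> Xrho Srho; apply/eqP; rewrite eq_le; apply/andP; split.
  apply: ereal_inf_lbound; exists 0 => //; split=> //.
  exists rho => //; rewrite scale0r addr0; exists 1 => //.
  by exists rho => //; rewrite scale1r.
by apply: le_ereal_inf_tmp => _ [s [s0 _] <-]; rewrite lee_fin.
Qed.

(** Traces in rho + s w = l y force l = 1 + s, whence rho - y = s (y - w). Leaving [X] abstract
    covers both robustness measures. *)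
Lemma robustness0_hull X rho : \tr rho = 1 ->
  (forall w, X w -> \tr w = 1) ->
  (forall w j k, X w -> normc (w j k) <= 1) ->
  robustness X (Splus V) rho = 0%E -> convex_hull (Splus V) rho.
Proof.
move=> rho1 X1 Xle1 rob0; apply: closed_entrywise; first exact: hull_Splus_closed.
move=> e e0.
have : (robustness X (Splus V) rho < (e / 2)%:E)%E.
  by rewrite rob0 lte_fin divr_gt0.
move=> /ereal_inf_lt[_ [s [s0 [w Xw [l l0 [y Sy ylE]]]] <-]].
rewrite lte_fin => se.
exists y => // j k.
have lE : l = 1 + s.
  have := congr1 mxtrace ylE; rewrite mxtraceD !mxtraceZ rho1.
  rewrite (convex_hull_mxtrace (Splus_mxtrace V_unit) Sy).
  by rewrite (convex_hull_mxtrace X1 Xw) !mulr1 => /(congr1 (@complex.Re R)).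
have -> : rho j k - y j k = s%:C * (y j k - w j k).
  have := congr1 (fun M : 'M[R[i]]_d => M j k) ylE.
  rewrite /= !mxE lE rmorphD/= => ylE'.
  by apply: (addIr (s%:C * w j k)); rewrite addrAC -ylE'; ring.
rewrite normcM normc_real//.
have : normc (y j k - w j k) <= 2.
  apply: le_trans (le_normcD _ _) _; rewrite normcN -[2]/(1 + 1) lerD//.
    apply: convex_hull_entry_le1 Sy => a Sa.
    exact/(Sket_entry_le1 V_unit)/Splus_sub_Sket.
  by apply: convex_hull_entry_le1 Xw => a; exact: Xle1.
move=> yw2; apply: (@le_lt_trans _ _ (s * 2)); first exact: ler_wpM2l.
by rewrite -ltr_pdivlMr.
Qed.

End faithfulness.

(** * Global phases and faithfulness of the six measures *)

(** The phase pi puts -v in [V], and -|v><v| = |-v><v|. *)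
Lemma Spm_sub_Sket (R : realType) d (V : set 'cV[R[i]]_d) :
  (forall (v : 'cV[R[i]]_d) (theta : R),
    V v -> V ((cos theta +i* sin theta) *: v)) ->
  Spm V `<=` Sket V.
Proof.
move=> V_phase a [Sa|[_ [v Vv <-] <-]]; first exact: Splus_sub_Sket.
exists (- v); last by exists v => //; rewrite /ketbra mulNmx.
rewrite -scaleN1r; have := V_phase v pi Vv; rewrite cospi sinpi.
by rewrite complexr0 rmorphN1.
Qed.

Lemma sube1_eq0 (R : realType) (x : \bar R) : (x - 1 = 0 <-> x = 1)%E.
Proof.
split=> [|->]; last by rewrite subee.
by case: x => [r| |] //= [] /eqP; rewrite subr_eq0 => /eqP ->.
Qed.


Theorem theorem14 (R : realType) (d : nat) (hd : (1 <= d)%N)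
    (V : set 'cV[R[i]]_d)
    (V_neq0 : V !=set0)
    (V_compact : compact V)
    (V_unit : forall v, V v -> unit_vector v)
    (V_phase : forall (v : 'cV[R[i]]_d) (theta : R),
       V v -> V ((cos theta +i* sin theta) *: v))
    (rho : 'M[R[i]]_d) (rho_density : density_matrix rho) :
  (convex_hull (Splus V) rho <->
     ((atomic_gauge (Splus V) rho - 1 = atomic_gauge (Sket V) rho - 1)%E /\
      (atomic_gauge (Sket V) rho - 1 = atomic_gauge (Spm V) rho - 1)%E /\
      (atomic_gauge (Spm V) rho - 1 = convex_roof V rho - 1)%E /\
      (convex_roof V rho - 1 = robustness (Splus V) (Splus V) rho)%E /\
      robustness (Splus V) (Splus V) rho
        = robustness density_matrix (Splus V) rho /\
      robustness density_matrix (Splus V) rho = 0%E))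
  /\
  ((atomic_gauge (Splus V) rho - 1 = 0)%E <-> convex_hull (Splus V) rho) /\
  ((atomic_gauge (Sket V) rho - 1 = 0)%E <-> convex_hull (Splus V) rho) /\
  ((atomic_gauge (Spm V) rho - 1 = 0)%E <-> convex_hull (Splus V) rho) /\
  ((convex_roof V rho - 1 = 0)%E <-> convex_hull (Splus V) rho) /\
  (robustness (Splus V) (Splus V) rho = 0%E <-> convex_hull (Splus V) rho) /\
  (robustness density_matrix (Splus V) rho = 0%E <->
     convex_hull (Splus V) rho).
Proof.
have [_ _ rho1] := rho_density.
have gauge_Splus : atomic_gauge (Splus V) rho = 1%E <-> convex_hull (Splus V) rho.
  by apply: gauge_eq1 => //; exact: Splus_sub_Sket.
have gauge_Sket : atomic_gauge (Sket V) rho = 1%E <-> convex_hull (Splus V) rho.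
  by apply: gauge_eq1 => //; exact: Splus_sub_Sket.
have gauge_Spm : atomic_gauge (Spm V) rho = 1%E <-> convex_hull (Splus V) rho.
  by apply: gauge_eq1 => // [a Sa|]; [left|exact: Spm_sub_Sket].
have roof := roof_eq1 V_unit V_compact rho1.
have rob_Splus : robustness (Splus V) (Splus V) rho = 0%E <->
    convex_hull (Splus V) rho.
  split=> [|Srho]; last exact: convex_hull_robustness.
  apply: robustness0_hull => // [w|w j k Sw]; first exact: Splus_mxtrace.
  exact/(Sket_entry_le1 V_unit)/Splus_sub_Sket.
have rob_density : robustness density_matrix (Splus V) rho = 0%E <->
    convex_hull (Splus V) rho.
  split=> [|Srho].
    apply: robustness0_hull => // [w []//|w j k]; exact: density_entry_le1.
  (* As a density matrix, rho lies in the hull of [density_matrix] as a one-term combination. *)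
  by apply: convex_hull_robustness => //; exact: convex_hull_sub.
split; last first.
  split; first exact: iff_trans (sube1_eq0 _) gauge_Splus.
  split; first exact: iff_trans (sube1_eq0 _) gauge_Sket.
  split; first exact: iff_trans (sube1_eq0 _) gauge_Spm.
  by split; first exact: iff_trans (sube1_eq0 _) roof.
(* The converse reads membership off the last equality of the chain, the vanishing of the
   generalised robustness. *)
split=> [Srho|[_ [_ [_ [_ [_ rob0]]]]]]; last exact/rob_density.
rewrite (gauge_Splus.2 Srho) (gauge_Sket.2 Srho) (gauge_Spm.2 Srho).
rewrite (roof.2 Srho) (rob_Splus.2 Srho) (rob_density.2 Srho).
by rewrite subee.
Qed.
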